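(* Let $n\ge 1$, let $0<r_j<\infty$ and $0<s_j<\infty$ for $j=1,\dots,n$, let $\mathbf{u}_1,\mathbf{u}_2\in\mathbb{C}^n$, and let $$\rho=W(\mathbf{u}_1)\gamma(\mathbf{r})W(\mathbf{u}_1)^{\dagger},\qquad \sigma=W(\mathbf{u}_2)\gamma(\mathbf{s})W(\mathbf{u}_2)^{\dagger},$$ where $\gamma(\mathbf{r})=\otimes_{j=1}^n\gamma(r_j)$ and $\gamma(\mathbf{s})=\otimes_{j=1}^n\gamma(s_j)$. Then for $\alpha\in(0,1)\cup(1,\infty)$, $$D_\alpha(\rho\|\sigma)<\infty \iff \alpha<\min\left\{\frac{s_j}{s_j-r_j} : j\in\{1,\dots,n\} \text{ such that } r_j<s_j\right\},$$ where the minimum of the empty set is taken to be $+\infty$.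
   Context: One-mode Fock space: $\ell^2(\mathbb{Z}_{\ge 0})$ with orthonormal particle (number) basis $\{|k\rangle\}_{k\ge0}$; the $n$-mode space is the $n$-fold tensor product with basis $|\mathbf{k}\rangle=|k_1\rangle\otimes\cdots\otimes|k_n\rangle$. For $0<s<\infty$ the one-mode thermal state is $\gamma(s)=(1-e^{-s})\sum_{k\ge0}e^{-ks}|k\rangle\langle k|$, and $\gamma(\infty)=|0\rangle\langle 0|$. For $u\in\mathbb{C}$ the exponential vector is $|e(v)\rangle=\sum_{k\ge0}\frac{v^k}{\sqrt{k!}}|k\rangle$, and the one-mode Weyl (displacement) unitary $W(u)$ is the unique unitary with $W(u)|e(v)\rangle=\exp(-\tfrac12|u|^2-\bar u v)|e(u+v)\rangle$ for all $v\in\mathbb{C}$; for $\mathbf{u}=(u_1,\dots,u_n)\in\mathbb{C}^n$, $W(\mathbf{u})=W(u_1)\otimes\cdots\otimes W(u_n)$. For states $\rho=\sum_i p_i|x_i\rangle\langle x_i|$, $\sigma=\sum_j q_j|y_j\rangle\langle y_j|$ (spectral decompositions with orthonormal bases $\{x_i\}$, $\{y_j\}$), the Petz–Rényi $\alpha$-relative entropy for $\alpha\in(0,1)\cup(1,\infty)$ is $D_\alpha(\rho\|\sigma)=\frac{1}{\alpha-1}\log\sum_{i,j}p_i^\alpha q_j^{1-\alpha}|\langle x_i|y_j\rangle|^2$, with the conventions (for $\alpha>1$) $0^{1-\alpha}=\infty$ and $0\cdot\infty=0$. *)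

(* Defs.v *)
From mathcomp Require Import all_boot all_order all_algebra.
From mathcomp Require Import all_classical all_reals all_analysis.
From mathcomp Require Import complex.
Set Implicit Arguments. Unset Strict Implicit. Unset Printing Implicit Defensive.
Import Order.TTheory GRing.Theory Num.Theory.
Import numFieldNormedType.Exports.
Local Open Scope classical_set_scope.
Local Open Scope ring_scope.

Section Fock.
Variable R : realType.
Local Notation C := R[i].

Definition csq (z : C) : R := complex.Re z ^+ 2 + complex.Im z ^+ 2.

(* one-mode Weyl matrix element <j| W(u) |k>.  It is obtained by comparing the
   coefficients of v^k on both sides of the defining identity
     W(u)|e(v)> = exp(-|u|^2/2 - conj(u) v) |e(u+v)>,
   i.e.  <j|W(u)|k> = sqrt(k!) [v^k] ( exp(-|u|^2/2) exp(-conj(u) v) (u+v)^j / sqrt(j!) ). *)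
Definition weyl_me (u : C) (j k : nat) : C :=
  Complex (Num.sqrt (k`!)%:R / Num.sqrt (j`!)%:R * expR (- csq u / 2)) 0 *
  \sum_(i < (minn j k).+1)
     ('C(j, i))%:R * u ^+ (j - i) * (- conjc u) ^+ (k - i) / ((k - i)`!)%:R.

(* one-mode overlap < W(u1)|k> , W(u2)|l> > = sum_m conj(<m|W(u1)|k>) <m|W(u2)|l>
   (inner product of l^2(Z_{>=0}), series taken as limit of partial sums of the
   real and imaginary parts); we record its squared modulus. *)
Definition overlap_re (u1 u2 : C) (k l : nat) : R^nat :=
  fun N => \sum_(m < N) complex.Re (conjc (weyl_me u1 m k) * weyl_me u2 m l).
Definition overlap_im (u1 u2 : C) (k l : nat) : R^nat :=
  fun N => \sum_(m < N) complex.Im (conjc (weyl_me u1 m k) * weyl_me u2 m l).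
Definition overlap_sq (u1 u2 : C) (k l : nat) : R :=
  limn (overlap_re u1 u2 k l) ^+ 2 + limn (overlap_im u1 u2 k l) ^+ 2.

Definition thermal_eig (s : R) (k : nat) : R := (1 - expR (- s)) * expR (- (k%:R * s)).

(* Petz-Renyi relative entropy from spectral data: rho = sum_i p i |x_i><x_i|,
   sigma = sum_j q j |y_j><y_j|, ovsq i j = |<x_i|y_j>|^2, with the conventions
   0^(1-alpha) = +oo for alpha > 1 and 0 * oo = 0 (mathcomp's mule). *)
Definition epow_neg (q a : R) : \bar R :=
  if (q == 0) && (1 < a) then +oo%E else (powR q (1 - a))%:E.

Definition elog (x : \bar R) : \bar R :=
  match x with
  | +oo%E => +oo%E
  | -oo%E => -oo%E
  | r%:E => if 0 < r then (ln r)%:E else -oo%E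
  end.

Definition petz_renyi (I J : choiceType) (alpha : R) (p : I -> R) (q : J -> R)
  (ovsq : I -> J -> R) : \bar R :=
  (((alpha - 1)^-1)%:E *
   elog (\esum_(ij in [set: I * J])
          ((powR (p ij.1) alpha)%:E * epow_neg (q ij.2) alpha
            * (ovsq ij.1 ij.2)%:E)))%E.

Definition mindex (n : nat) := {ffun 'I_n -> nat}.

(* eigenvalue of gamma(r) = (x)_j gamma(r_j) on |k>; the displaced state
   W(u) gamma(r) W(u)^dagger has the same eigenvalue on the eigenvector W(u)|k> *)
Definition thermal_eig_n (n : nat) (r : 'I_n -> R) (k : mindex n) : R :=
  \prod_(j < n) thermal_eig (r j) (k j).

Definition overlap_sq_n (n : nat) (u1 u2 : 'I_n -> C) (k l : mindex n) : R :=
  \prod_(j < n) overlap_sq (u1 j) (u2 j) (k j) (l j).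

Definition D_gauss (n : nat) (alpha : R) (r s : 'I_n -> R) (u1 u2 : 'I_n -> C) : \bar R :=
  petz_renyi alpha (thermal_eig_n r) (thermal_eig_n s) (overlap_sq_n u1 u2).

End Fock.

(* Main.v *)
Require Import Defs.
From mathcomp Require Import all_boot all_order all_algebra.
From mathcomp Require Import all_classical all_reals all_analysis.
From mathcomp Require Import complex ring lra zify.
Import Order.TTheory GRing.Theory Num.Theory.
Import numFieldNormedType.Exports.
Import Normc.
Local Open Scope classical_set_scope.
Local Open Scope ring_scope.

(* Up to the factor exp (- |w|^2 / 2), the matrix element <k|W(w)|l> is sqrt (k! l!)
   times the coefficient of s^k t^l in exp (w s - conj w t + s t).
   The two-term recurrence of these coefficients sums the series defining the overlap
   <W(u1) k | W(u2) l>, and shows that its squared modulus is a positive constant times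
   the squared modulus O_kl of the matrix element for w = u2 - u1.

   With A = exp (- alpha r) and B = exp ((alpha - 1) s), one mode contributes, up to
   a constant, the sum of A^k B^l O_kl, and the condition on alpha says A B < 1.
   If A B < 1, the sum converges: Cauchy-Schwarz and 'C(k, p) e^(k - p) <= (1 + e)^k
   bound it by a geometric series of ratio A B (1 + e)^3 times two exponential series.
   If A B >= 1, it diverges: O is symmetric, so A^k B^l may be replaced by
   (A^k B^l + A^l B^k) / 2 >= 1, and every row sum of O is the same positive number,
   by unitarity.  For alpha < 1 the entropy is finite as soon as the sum is nonzero. *)

(** * Taylor coefficients of exp (a s + b t + s t) and their recurrences *)

Lemma natr_fact_neq0 (F : numDomainType) (n : nat) : n`!%:R != 0 :> F.
Proof. by rewrite pnatr_eq0 -lt0n fact_gt0. Qed.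

(** The guard makes the term vanish where the truncated subtractions [k - p] and [l - p] would be
    wrong, so that sums over p may be extended to any larger bound. *)
Definition weyl_term {F : numFieldType} (a b : F) (k l p : nat) : F :=
  if (p <= k)%N && (p <= l)%N then
    a ^+ (k - p) * b ^+ (l - p) / (p`!%:R * (k - p)`!%:R * (l - p)`!%:R)
  else 0.

(* The Taylor coefficients of exp (a s + b t + s t). *)
Definition weyl_coef {F : numFieldType} (a b : F) (k l : nat) : F :=
  \sum_(p < (minn k l).+1) weyl_term a b k l p.

Lemma weyl_coef_widen (F : numFieldType) (a b : F) (k l N : nat) :
  (minn k l < N)%N -> weyl_coef a b k l = \sum_(p < N) weyl_term a b k l p.
Proof.
move=> hN; rewrite /weyl_coef -!(big_mkord xpredT (weyl_term a b k l)).
rewrite [RHS](@big_cat_nat _ _ _ (minn k l).+1) //=.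
rewrite [X in _ + X]big_nat_cond [X in _ + X]big1 ?addr0 // => p.
rewrite andbT => /andP[hp _]; rewrite /weyl_term.
by rewrite -leq_min leqNgt hp.
Qed.

Lemma weyl_termC (F : numFieldType) (a b : F) (k l p : nat) :
  weyl_term a b k l p = weyl_term b a l k p.
Proof.
rewrite /weyl_term andbC; case: ifP => // _.
by rewrite [a ^+ _ * _]mulrC [p`!%:R * _ * _]mulrAC.
Qed.

Lemma weyl_coefC (F : numFieldType) (a b : F) (k l : nat) :
  weyl_coef a b k l = weyl_coef b a l k.
Proof.
by rewrite /weyl_coef minnC; apply: eq_bigr => p _; exact: weyl_termC.
Qed.

Lemma weyl_coef0l (F : numFieldType) (a b : F) (l : nat) :
  weyl_coef a b 0 l = b ^+ l / l`!%:R.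
Proof.
rewrite /weyl_coef min0n big_ord1 /weyl_term !leq0n /= !subn0 expr0 fact0.
by rewrite !mul1r.
Qed.

(** Write k + 1 = (k + 1 - p) + p. The first part cancels a factor of (k + 1 - p)! and leaves one
    factor a; the second cancels a factor of p! and lowers both p and l. *)
Lemma weyl_term_rec (F : numFieldType) (a b : F) (k l p : nat) :
  k.+1%:R * weyl_term a b k.+1 l p =
  a * weyl_term a b k l p +
  (if p is q.+1 then (if l is l'.+1 then weyl_term a b k l' q else 0) else 0).
Proof.
rewrite /weyl_term.
case: (leqP p l) => hpl; last first.
  rewrite !andbF !mulr0 add0r; case: p hpl => // q; case: l => // l.
  by rewrite ltnS => hl; rewrite (leqNgt q l) hl andbF.
rewrite !andbT.
case: (ltngtP p k.+1) => hpk.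
- rewrite -ltnS hpk.
  have hpk' : (p <= k)%N by [].
  rewrite (subSn hpk') exprS factS natrM.
  have f1 := natr_fact_neq0 F (k - p); have f2 := natr_fact_neq0 F (l - p).
  have f3 := natr_fact_neq0 F p.
  have f4 : ((k - p).+1%:R != 0 :> F) by rewrite pnatr_eq0.
  case: p hpl hpk hpk' f1 f2 f3 f4 => [|q] hpl hpk hpk' f1 f2 f3 f4.
    rewrite !subn0 in f1 f2 f4 *.
    rewrite addr0; move: k.+1%:R f4 => x f4.
    by field; rewrite f1 f2 f3 f4.
  case: l hpl f2 => // l hpl f2.
  rewrite (_ : (q <= k)%N && (q <= l)%N); last by lia.
  rewrite !subSS in f2 *.
  have -> : (k - q = (k - q.+1).+1)%N by lia.
  rewrite exprS !factS !natrM.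
  have f5 : (q.+1%:R != 0 :> F) by rewrite pnatr_eq0.
  have f6 := natr_fact_neq0 F q.
  rewrite (_ : k.+1%:R = (k - q.+1).+1%:R + q.+1%:R :> F); last first.
    by rewrite -natrD; congr (_%:R); lia.
  move: (k - q.+1).+1%:R q.+1%:R f4 f5 => x y f4 f5.
  by field; rewrite f1 f2 f4 f5 f6.
- by rewrite leqNgt (ltn_trans _ hpk) //= !mulr0 add0r; case: p hpl hpk => // q;
    case: l => // l _; rewrite ltnS => hk; rewrite (leqNgt q k) hk.
- rewrite hpk in hpl *; rewrite ltnn mulr0 add0r subnn.
  case: l hpl => // l hpl; rewrite leqnn -ltnS hpl /= subnn subSS factS natrM.
  have f1 := natr_fact_neq0 F k; have f2 := natr_fact_neq0 F (l - k).
  have f4 : (k.+1%:R != 0 :> F) by rewrite pnatr_eq0.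
  rewrite expr0 fact0; move: k.+1%:R f4 => x f4.
  by field; rewrite f1 f2 f4.
Qed.

(** The derivative of exp (a s + b t + s t) in s is a + t times this function. *)
Lemma weyl_coef_rec (F : numFieldType) (a b : F) (k l : nat) :
  k.+1%:R * weyl_coef a b k.+1 l =
  a * weyl_coef a b k l + (if l is l'.+1 then weyl_coef a b k l' else 0).
Proof.
rewrite (@weyl_coef_widen _ a b k.+1 l l.+1); last by lia.
rewrite (@weyl_coef_widen _ a b k l l.+1); last by lia.
rewrite !mulr_sumr; under eq_bigr do rewrite weyl_term_rec.
rewrite big_split /=; congr (_ + _); rewrite big_ord_recl /= add0r.
case: l => [|l]; first by rewrite big_ord0.
by rewrite (@weyl_coef_widen _ a b k l l.+1) //; lia.
Qed.

Lemma weyl_coef_recr (F : numFieldType) (a b : F) (k l : nat) :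
  l.+1%:R * weyl_coef a b k l.+1 =
  b * weyl_coef a b k l + (if k is k'.+1 then weyl_coef a b k' l else 0).
Proof.
rewrite weyl_coefC weyl_coef_rec weyl_coefC; congr (_ + _).
by case: k => // k; exact: weyl_coefC.
Qed.

(** * Partial sums of the overlap series, without normalization *)

Definition weyl_prod {F : numFieldType} (a b c d : F) (k l N : nat) : F :=
  \sum_(m < N) m`!%:R * weyl_coef a b m k * weyl_coef c d m l.

Lemma weyl_prodC (F : numFieldType) (a b c d : F) (k l N : nat) :
  weyl_prod a b c d k l N = weyl_prod c d a b l k N.
Proof. by apply: eq_bigr => m _; rewrite mulrAC. Qed.

Lemma weyl_prod00 (F : numFieldType) (a b c d : F) (N : nat) :
  weyl_prod a b c d 0 0 N = \sum_(m < N) (a * c) ^+ m / m`!%:R.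
Proof.
apply: eq_bigr => m _; rewrite ![weyl_coef _ _ _ 0]weyl_coefC !weyl_coef0l exprMn.
by have f := natr_fact_neq0 F m; field.
Qed.

(* Multiply by k+1, use the recurrence in k, shift m in the second term, and use
   the recurrence in m. *)
Lemma weyl_prod_rec (F : numFieldType) (a b c d : F) (k l N : nat) :
  k.+1%:R * weyl_prod a b c d k.+1 l N.+1 =
  b * weyl_prod a b c d k l N.+1 + c * weyl_prod a b c d k l N +
  (if l is l'.+1 then weyl_prod a b c d k l' N else 0).
Proof.
rewrite mulr_sumr.
transitivity (\sum_(m < N.+1) (b * (m`!%:R * weyl_coef a b m k * weyl_coef c d m l) +
   m`!%:R * (if nat_of_ord m is m'.+1 then weyl_coef a b m' k else 0) *
   weyl_coef c d m l)).
  apply: eq_bigr => m _.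
  transitivity (m`!%:R * (k.+1%:R * weyl_coef a b m k.+1) * weyl_coef c d m l).
    by ring.
  by rewrite weyl_coef_recr mulrDr mulrDl; congr (_ + _); ring.
rewrite big_split /= -addrA -mulr_sumr; congr (_ + _).
rewrite big_ord_recl /= mulr0 mul0r add0r.
transitivity (\sum_(m < N) (c * (m`!%:R * weyl_coef a b m k * weyl_coef c d m l) +
   (if l is l'.+1 then m`!%:R * weyl_coef a b m k * weyl_coef c d m l' else 0))).
  apply: eq_bigr => m _.
  rewrite /bump /= add1n factS natrM.
  transitivity (m`!%:R * weyl_coef a b m k * (m.+1%:R * weyl_coef c d m.+1 l)).
    ring.
  rewrite weyl_coef_rec; case: l => [|l]; ring.
rewrite big_split /= -mulr_sumr; congr (_ + _).
by case: l => [|l] //; rewrite big1.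
Qed.

(** * Modulus and convergence of complex numbers *)

Lemma csqE (R : realType) (z : R[i]) : csq z = normc z ^+ 2.
Proof. by case: z => a b /=; rewrite sqr_sqrtr // addr_ge0 ?sqr_ge0. Qed.

Lemma csqM (R : realType) (z w : R[i]) : csq (z * w) = csq z * csq w.
Proof. by rewrite !csqE normcM exprMn. Qed.

Lemma csq_ge0 (R : realType) (z : R[i]) : 0 <= csq z.
Proof. by rewrite csqE sqr_ge0. Qed.

Lemma csq_gt0 (R : realType) (z : R[i]) : z != 0 -> 0 < csq z.
Proof.
move=> z0; rewrite csqE exprn_even_gt0 //=.
by apply: contra z0 => /eqP/eq0_normc ->.
Qed.

Lemma csqX (R : realType) (z : R[i]) (n : nat) : csq (z ^+ n) = csq z ^+ n.
Proof.
elim: n => [|n IH]; last by rewrite !exprS csqM IH.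
by rewrite !expr0 csqE normc1 expr1n.
Qed.

Lemma csqR (R : realType) (x : R) : csq (Complex x 0) = x ^+ 2.
Proof. by rewrite /csq /= expr0n addr0. Qed.

Lemma csq_conjc (R : realType) (z : R[i]) : csq (conjc z) = csq z.
Proof. by case: z => a b; rewrite /csq /= sqrrN. Qed.

Lemma csqN (R : realType) (z : R[i]) : csq (- z) = csq z.
Proof. by case: z => a b; rewrite /csq /= !sqrrN. Qed.

Lemma conjc_mul_self (R : realType) (z : R[i]) : conjc z * z = Complex (csq z) 0.
Proof.
case: z => a b; rewrite /csq; apply/eqP; rewrite eq_complex /=.
by apply/andP; split; apply/eqP; ring.
Qed.

Lemma normc_ge0 (R : realType) (z : R[i]) : 0 <= normc z.
Proof. by case: z => a b; exact: sqrtr_ge0. Qed.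

Lemma Re_le_normc (R : realType) (z : R[i]) : `|complex.Re z| <= normc z.
Proof.
case: z => a b /=; rewrite -sqrtr_sqr ler_sqrt ?addr_ge0 ?sqr_ge0 //.
by rewrite lerDl sqr_ge0.
Qed.

Lemma Im_le_normc (R : realType) (z : R[i]) : `|complex.Im z| <= normc z.
Proof.
case: z => a b /=; rewrite -sqrtr_sqr ler_sqrt ?addr_ge0 ?sqr_ge0 //.
by rewrite lerDr sqr_ge0.
Qed.

Lemma normcX (R : realType) (z : R[i]) (n : nat) : normc (z ^+ n) = normc z ^+ n.
Proof.
elim: n => [|n IH]; last by rewrite !exprS normcM IH.
by rewrite !expr0 normc1.
Qed.

Lemma normc_natr (R : realType) (n : nat) : normc (n%:R : R[i]) = n%:R.
Proof. by rewrite (normcMn (1 : R[i])) normc1. Qed.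

Lemma le_normc_sum (R : realType) (I : finType) (P : pred I) (f : I -> R[i]) :
  normc (\sum_(i | P i) f i) <= \sum_(i | P i) normc (f i).
Proof.
elim/big_ind2: _ => [|x1 x2 y1 y2 h1 h2|//]; first by rewrite normc0.
by apply: le_trans (le_normcD _ _) _; exact: lerD.
Qed.

(** Convergence is taken by components because [overlap_sq] is built from the separate limits of
    real and imaginary parts. *)
Definition ccvg {R : realType} (f : nat -> R[i]) (l : R[i]) : Prop :=
  (complex.Re (f n) @[n --> \oo] --> complex.Re l) /\
  (complex.Im (f n) @[n --> \oo] --> complex.Im l).

Lemma ccvg_cst {R : realType} (c : R[i]) : ccvg (fun=> c) c.
Proof. by split; exact: cvg_cst. Qed.

Lemma ccvgD {R : realType} (f g : nat -> R[i]) (l m : R[i]) :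
  ccvg f l -> ccvg g m -> ccvg (fun n => f n + g n) (l + m).
Proof.
move=> [f1 f2] [g1 g2]; split.
  rewrite raddfD; under eq_fun do rewrite raddfD; exact: cvgD.
rewrite raddfD; under eq_fun do rewrite raddfD; exact: cvgD.
Qed.

Lemma ReM {R : realType} (z w : R[i]) :
  complex.Re (z * w) = complex.Re z * complex.Re w - complex.Im z * complex.Im w.
Proof. by case: z w => a b [c d]. Qed.

Lemma ImM {R : realType} (z w : R[i]) :
  complex.Im (z * w) = complex.Re z * complex.Im w + complex.Im z * complex.Re w.
Proof. by case: z w => a b [c d]. Qed.

Lemma ccvgM {R : realType} (f g : nat -> R[i]) (l m : R[i]) :
  ccvg f l -> ccvg g m -> ccvg (fun n => f n * g n) (l * m).
Proof.
move=> [f1 f2] [g1 g2]; split.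
  rewrite ReM; under eq_fun do rewrite ReM.
  by apply: cvgB; apply: cvgM.
rewrite ImM; under eq_fun do rewrite ImM.
by apply: cvgD; apply: cvgM.
Qed.

Lemma ccvg_shiftS {R : realType} (f : nat -> R[i]) (l : R[i]) :
  ccvg (fun n => f n.+1) l <-> ccvg f l.
Proof.
rewrite /ccvg.
have h (u : nat -> R) (x : R) : (u n.+1 @[n --> \oo] --> x) = (u n @[n --> \oo] --> x).
  exact: (cvg_shiftS u).
by rewrite (h (fun n => complex.Re (f n))) (h (fun n => complex.Im (f n))).
Qed.

(** * Complex exponential series and the limit of the overlap sums *)

Definition exp_sum {F : numFieldType} (z : F) (N : nat) : F :=
  \sum_(m < N) z ^+ m / m`!%:R.

Lemma exp_sum_cvg (R : realType) (x : R) : exp_sum x n @[n --> \oo] --> expR x.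
Proof.
rewrite (_ : (fun n => exp_sum x n) = series (exp_coeff x)); last first.
  by apply/funext => n; rewrite /series /= big_mkord.
exact: is_cvg_series_exp_coeff.
Qed.

(** Both sides run over the pairs with p + q < N; the right side groups them by n = p + q. The
    induction adds the diagonal p + q = N. *)
Lemma sum_triangle (V : zmodType) (F : nat -> nat -> V) (N : nat) :
  \sum_(p < N) \sum_(q < N - p) F p q = \sum_(n < N) \sum_(p < n.+1) F p (n - p)%N.
Proof.
elim: N => [|N IH]; first by rewrite !big_ord0.
rewrite [RHS]big_ord_recr /= -IH.
transitivity (\sum_(p < N.+1) (\sum_(q < N - p) F p q + F p (N - p)%N)).
  apply: eq_bigr => p _; rewrite subSn; last by rewrite -ltnS.
  by rewrite big_ord_recr.
rewrite big_split /=; congr (_ + _).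
by rewrite big_ord_recr /= subnn big_ord0 addr0.
Qed.

Definition exp_sum_cross {F : numFieldType} (x y : F) (N : nat) : F :=
  \sum_(p < N) \sum_(q < N | (N - p <= q)%N) x ^+ p / p`!%:R * (y ^+ q / q`!%:R).

(** By the binomial formula, the pairs with p + q < N give the truncated series of x + y;
    [exp_sum_cross] collects the remaining pairs. *)
Lemma exp_sumM (F : numFieldType) (x y : F) (N : nat) :
  exp_sum x N * exp_sum y N = exp_sum (x + y) N + exp_sum_cross x y N.
Proof.
rewrite /exp_sum big_distrlr /=.
transitivity (\sum_(p < N) (\sum_(q < N - p) x ^+ p / p`!%:R * (y ^+ q / q`!%:R) +
   \sum_(q < N | (N - p <= q)%N) x ^+ p / p`!%:R * (y ^+ q / q`!%:R))).
  apply: eq_bigr => p _.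
  rewrite (bigID (fun q : 'I_N => (q < N - p)%N)) /=; congr (_ + _).
    by rewrite [RHS](big_ord_widen N (fun q => x ^+ p / p`!%:R * (y ^+ q / q`!%:R)))
      ?leq_subr.
  by apply: eq_bigl => q; rewrite -leqNgt.
rewrite big_split /=; congr (_ + _).
rewrite (sum_triangle _ (fun p q => x ^+ p / p`!%:R * (y ^+ q / q`!%:R))).
apply: eq_bigr => n _; rewrite addrC exprDn mulr_suml; apply: eq_bigr => p _.
have hp : (p <= n)%N by rewrite -ltnS.
have := bin_fact hp => /(congr1 (fun k => k%:R : F)); rewrite !natrM => <-.
have f1 := natr_fact_neq0 F p; have f2 := natr_fact_neq0 F (n - p).
have f3 : ('C(n, p)%:R != 0 :> F) by rewrite pnatr_eq0 -lt0n bin_gt0.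
by rewrite -mulr_natr; field; rewrite f1 f2 f3.
Qed.

(** The real and imaginary parts of the terms are dominated by the terms of the real series at
    |z|. *)
Lemma exp_sum_cvg_complex (R : realType) (z : R[i]) : exists E, ccvg (exp_sum z) E.
Proof.
pose u (g : R[i] -> R) n := g (z ^+ n / n`!%:R).
have key (g : R[i] -> R) : (forall w, `|g w| <= normc w) -> cvgn (series (u g)).
  move=> hg; apply: normed_cvg.
  apply: (@series_le_cvg _ _ (exp_coeff (normc z))) => [n|n|n|].
  - exact: normr_ge0.
  - exact: exp_coeff_ge0 (normc_ge0 _ _).
  - apply: le_trans (hg _) _.
    by rewrite normcM normcV normcX normc_natr.
  - exact: is_cvg_series_exp_coeff.
exists (Complex (limn (series (u (@complex.Re R)))) (limn (series (u (@complex.Im R))))).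
split => /=.
  rewrite (_ : (fun n => _) = series (u (@complex.Re R))).
    exact: key (@Re_le_normc R).
  by apply/funext => n; rewrite /series /= big_mkord raddf_sum.
rewrite (_ : (fun n => _) = series (u (@complex.Im R))).
  exact: key (@Im_le_normc R).
by apply/funext => n; rewrite /series /= big_mkord raddf_sum.
Qed.

(* [exp_sum z N * exp_sum (- z) N - 1] is a sum of cross terms that is dominated by
   [exp_sum |z| N ^ 2 - exp_sum (2 |z|) N], which tends to 0. *)
Lemma exp_sum_lim_neq0 (R : realType) (z E : R[i]) : ccvg (exp_sum z) E -> E != 0.
Proof.
move=> hE; have [E' hE'] := exp_sum_cvg_complex R (- z).
apply/eqP => E0.
have [+ _] := ccvgM _ _ _ _ hE hE'; rewrite E0 mul0r /=.
set x := normc z.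
have cross0 : exp_sum_cross x x n @[n --> \oo] --> (0 : R).
  rewrite (_ : (fun n => _) = fun n => exp_sum x n * exp_sum x n - exp_sum (x + x) n).
    rewrite -(subrr (expR (x + x))) {1}expRD.
    by apply: cvgB; [apply: cvgM|]; exact: exp_sum_cvg.
  by apply/funext => n; rewrite exp_sumM addrC addKr.
move=> h.
suff : (fun n => complex.Re (exp_sum z n * exp_sum (- z) n)) @ \oo --> (1 : R).
  move=> h1; have e01 : 0 = 1 :> R by exact: (cvg_unique _ h h1).
  by move/eqP: e01; rewrite eq_sym oner_eq0.
apply/(@cvgrPdist_le _ R^o) => e e0.
move/(@cvgrPdist_le _ R^o): cross0 => /(_ _ e0) [M _ hM].
(* Starting from [M.+1] excludes the empty sum: [exp_sum 0 N] equals 1 only for N > 0. *)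
exists M.+1 => // -[//|n] hn.
have /= := hM n.+1 (ltnW hn).
rewrite sub0r normrN; apply: le_trans; apply: le_trans (ler_norm _).
rewrite exp_sumM subrr {1}/exp_sum big_ord_recl expr0 fact0 divr1 big1 => [|i _]; last first.
  by rewrite exprS mul0r mul0r.
rewrite addr0 raddfD /= opprD addrA subrr sub0r normrN.
apply: le_trans (Re_le_normc _ _) _; apply: le_trans (le_normc_sum _ _ _ _) _.
apply: ler_sum => p _; apply: le_trans (le_normc_sum _ _ _ _) _.
apply: ler_sum => q _.
by rewrite !normcM !normcV !normcX normcN !normc_natr.
Qed.

(** On generating functions, the sum over m of m! times the products of the s^m coefficients of exp
    ((a + x) s + b x) and exp ((c + y) s + d y) is exp (b x + d y + (a + c') y') with a + c' and y'
    standing for the factors a + x and c + y, that is exp (a c) exp ((b + c) x + (a + d) y + x y).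
    The proof runs this through the recurrences, with E in place of exp (a c). *)
Lemma weyl_prod_cvg (R : realType) (a b c d E : R[i]) (k l : nat) :
  ccvg (exp_sum (a * c)) E ->
  ccvg (weyl_prod a b c d k l) (E * weyl_coef (b + c) (a + d) k l).
Proof.
move=> hE.
have step (a' b' c' d' L1 L2 : R[i]) (i j : nat) :
    ccvg (weyl_prod a' b' c' d' i j) L1 ->
    ccvg (fun N => if j is j'.+1 then weyl_prod a' b' c' d' i j' N else 0) L2 ->
    ccvg (weyl_prod a' b' c' d' i.+1 j) (i.+1%:R^-1 * ((b' + c') * L1 + L2)).
  move=> h1 h2; apply/ccvg_shiftS.
  have -> : (fun N => weyl_prod a' b' c' d' i.+1 j N.+1) =
     (fun N => i.+1%:R^-1 * (b' * weyl_prod a' b' c' d' i j N.+1 +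
       c' * weyl_prod a' b' c' d' i j N +
       (if j is j'.+1 then weyl_prod a' b' c' d' i j' N else 0))).
    by apply/funext => N; rewrite -weyl_prod_rec mulKf.
  apply: ccvgM; first exact: ccvg_cst.
  apply: ccvgD => //; rewrite mulrDl; apply: ccvgD; apply: ccvgM => //;
    try exact: ccvg_cst.
  exact/ccvg_shiftS.
have rec (x y : R[i]) (i j : nat) : weyl_coef x y i.+1 j = i.+1%:R^-1 *
    (x * weyl_coef x y i j + (if j is j'.+1 then weyl_coef x y i j' else 0)).
  by rewrite -weyl_coef_rec mulKf.
elim: k l => [|k IH] l.
  elim: l => [|l IH].
    rewrite weyl_coef0l expr0 fact0 divr1 mulr1.
    by move: hE; congr (ccvg _ _); apply/funext => N; rewrite weyl_prod00.
  rewrite weyl_coefC rec /= addr0 -weyl_coefC.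
  (* Exchanging (a, b) with (c, d) exchanges k and l, so [step] also moves along the row k = 0. *)
  have := step c d a b _ 0 l 0%N.
  have e i j : weyl_prod c d a b i j = weyl_prod a b c d j i.
    by apply/funext => N; exact: weyl_prodC.
  rewrite !e => /(_ _ IH (ccvg_cst _)); congr (ccvg _ _).
  by rewrite addr0 (addrC d a) [RHS]mulrCA; congr (_ * _); exact: mulrCA.
rewrite rec [E * _]mulrCA mulrDr [E * (_ * _)]mulrCA.
apply: step (IH l) _.
case: l => [|l]; last exact: IH.
by rewrite mulr0; exact: ccvg_cst.
Qed.

(** * Symmetries of the coefficients, Weyl matrix elements and overlaps *)

Lemma rmorph_weyl_coef (F F' : numFieldType) (h : {rmorphism F -> F'}) (a b : F) (k l : nat) :
  h (weyl_coef a b k l) = weyl_coef (h a) (h b) k l.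
Proof.
rewrite /weyl_coef rmorph_sum; apply: eq_bigr => p _; rewrite /weyl_term.
case: ifP => _; last exact: rmorph0.
by rewrite fmorph_div !rmorphM !rmorphXn !rmorph_nat.
Qed.

(** The exponents k - p and l - p add up to k + l - 2 p, so the sign is the same for every p. *)
Lemma weyl_coefN (F : numFieldType) (a b : F) (k l : nat) :
  weyl_coef (- a) (- b) k l = (-1) ^+ (k + l) * weyl_coef a b k l.
Proof.
rewrite /weyl_coef mulr_sumr; apply: eq_bigr => p _; rewrite /weyl_term.
case: ifP => [/andP[pk pl]|]; last by rewrite mulr0.
rewrite (exprNn a) (exprNn b).
have -> : (-1) ^+ (k + l) = (-1) ^+ (k - p) * (-1) ^+ (l - p) :> F.
  have -> : (k + l = (k - p) + (l - p) + 2 * p)%N by lia.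
  by rewrite exprD exprM sqrrN expr1n expr1n mulr1 exprD.
by rewrite !mulrA; congr (_ / _); ring.
Qed.

Lemma weyl_coef00 (F : numFieldType) (k : nat) :
  weyl_coef (0 : F) 0 k k = k`!%:R^-1.
Proof.
rewrite /weyl_coef minnn big_ord_recr /= big1 => [|p _]; last first.
  rewrite /weyl_term; case: ifP => // _; rewrite expr0n subn_eq0 leqNgt ltn_ord /=.
  by rewrite !mul0r.
by rewrite add0r /weyl_term leqnn subnn expr0 fact0 !mulr1 div1r.
Qed.

Lemma complexrM (R : realType) (x y : R) : Complex x 0 * Complex y 0 = Complex (x * y) 0.
Proof. exact/esym/(rmorphM (real_complex R)). Qed.

Lemma complexr_nat (R : realType) (n : nat) : n%:R = Complex n%:R 0 :> R[i].
Proof. exact/esym/(rmorph_nat (real_complex R)). Qed.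

(** Since 'C(j, p) = j! / (p! (j - p)!), a factor j! comes out of the sum, and j! / sqrt (j!) = sqrt
    (j!). *)
Lemma weyl_meE (R : realType) (u : R[i]) (j k : nat) :
  weyl_me u j k =
  Complex (Num.sqrt k`!%:R * Num.sqrt j`!%:R * expR (- csq u / 2)) 0 *
    weyl_coef u (- conjc u) j k.
Proof.
rewrite /weyl_me.
set S := \sum_(_ < _) _.
have -> : S = Complex j`!%:R 0 * weyl_coef u (- conjc u) j k.
  rewrite /S /weyl_coef mulr_sumr; apply: eq_bigr => p _; rewrite /weyl_term.
  have hp : (p <= minn j k)%N by rewrite -ltnS.
  rewrite -leq_min hp.
  have hpj : (p <= j)%N by move: hp; rewrite leq_min => /andP[].
  have := bin_fact hpj => /(congr1 (fun k => k%:R : R[i])); rewrite !natrM.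
  rewrite -complexr_nat => <-.
  have f1 := natr_fact_neq0 R[i] p; have f2 := natr_fact_neq0 R[i] (j - p).
  have f3 := natr_fact_neq0 R[i] (k - p).
  by field; rewrite f1 f2 f3.
rewrite mulrA; congr (_ * _).
rewrite complexrM; congr (Complex _ 0).
have h : 0 < Num.sqrt j`!%:R :> R by rewrite sqrtr_gt0 ltr0n fact_gt0.
have -> : j`!%:R = Num.sqrt j`!%:R ^+ 2 :> R by rewrite sqr_sqrtr.
by rewrite sqrtr_sqr ger0_norm ?ltW //; field; rewrite gt_eqF.
Qed.

(* |<k|W(w)|l>|^2 up to the factor exp (- |w|^2). *)
Definition weyl_weight {R : realType} (w : R[i]) (k l : nat) : R :=
  k`!%:R * l`!%:R * csq (weyl_coef w (- conjc w) k l).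

Lemma weyl_weight_ge0 (R : realType) (w : R[i]) (k l : nat) : 0 <= weyl_weight w k l.
Proof. by rewrite !mulr_ge0 ?csq_ge0. Qed.

Lemma weyl_weight00 (R : realType) (w : R[i]) : weyl_weight w 0 0 = 1.
Proof.
rewrite /weyl_weight weyl_coef0l expr0 fact0 divr1 !mul1r.
by rewrite (csqR _ 1) expr1n.
Qed.

(** Conjugation and exchange of the indices turn the parameters (w, - conj w) into (- w, conj w);
    this sign change does not affect the modulus. *)
Lemma weyl_weightC (R : realType) (w : R[i]) (k l : nat) :
  weyl_weight w k l = weyl_weight w l k.
Proof.
rewrite /weyl_weight [k`!%:R * _]mulrC; congr (_ * _).
rewrite -csq_conjc (rmorph_weyl_coef _ _ (@conjc R)) rmorphN /= conjcK weyl_coefC.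
have -> : conjc w = - (- conjc w) by rewrite opprK.
rewrite weyl_coefN csqM csqX csqN (csqR _ 1) !expr1n mul1r.
by rewrite opprK.
Qed.

Lemma conjc_weyl_me_mul (R : realType) (u v : R[i]) (m k l : nat) :
  conjc (weyl_me u m k) * weyl_me v m l =
  Complex (Num.sqrt k`!%:R * Num.sqrt l`!%:R *
    (expR (- csq u / 2) * expR (- csq v / 2))) 0 *
  (m`!%:R * weyl_coef (conjc u) (- u) m k * weyl_coef v (- conjc v) m l).
Proof.
rewrite !weyl_meE rmorphM /= (rmorph_weyl_coef _ _ (@conjc R)) rmorphN /= conjcK oppr0.
rewrite mulrACA -[m`!%:R * _ * _]mulrA [RHS]mulrA; congr (_ * _).
rewrite complexr_nat !complexrM. congr (Complex _ 0).
have -> : m`!%:R = Num.sqrt m`!%:R ^+ 2 :> R by rewrite sqr_sqrtr.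
by rewrite sqrtr_sqr ger0_norm ?sqrtr_ge0 //; ring.
Qed.

(** This reflects that W(u)^* W(v) is W(v - u) up to a phase. In [weyl_prod_cvg] the parameters
    (conj u, - u) and (v, - conj v) give b + c = v - u and a + d = - conj (v - u), and the limit E
    of the exponential series is nonzero. *)
Lemma overlap_sqE (R : realType) (u v : R[i]) :
  exists2 c : R, 0 < c & forall k l, overlap_sq u v k l = c * weyl_weight (v - u) k l.
Proof.
have [E hE] := exp_sum_cvg_complex R (conjc u * v).
set e := expR (- csq u / 2) * expR (- csq v / 2).
have e0 : 0 < e by rewrite mulr_gt0 ?expR_gt0.
exists (e ^+ 2 * csq E).
  by rewrite mulr_gt0 ?exprn_gt0 // csq_gt0 //; exact: exp_sum_lim_neq0 hE.
move=> k l.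
set K := Complex (Num.sqrt k`!%:R * Num.sqrt l`!%:R * e) 0.
have := weyl_prod_cvg R (conjc u) (- u) v (- conjc v) E k l hE.
move=> /(ccvgM _ _ _ _ (ccvg_cst K)) [].
have eq1 N : K * weyl_prod (conjc u) (- u) v (- conjc v) k l N =
    \sum_(m < N) conjc (weyl_me u m k) * weyl_me v m l.
  by rewrite mulr_sumr; apply: eq_bigr => m _; rewrite conjc_weyl_me_mul.
rewrite (_ : (fun n => complex.Re _) = overlap_re u v k l); last first.
  by apply/funext => N; rewrite eq1 raddf_sum.
rewrite (_ : (fun n => complex.Im _) = overlap_im u v k l); last first.
  by apply/funext => N; rewrite eq1 raddf_sum.
move=> /cvg_lim h1 /cvg_lim h2.
rewrite /overlap_sq h1 // h2 // -/(csq _) !csqM csqR /weyl_weight.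
rewrite (addrC v) rmorphD rmorphN /= opprD opprK.
by rewrite !exprMn !sqr_sqrtr //; ring.
Qed.

(** * Row sums of the weight, and divergence for A B >= 1 *)

Lemma exp_sumR_cvg (R : realType) (x : R) : ccvg (exp_sum (x%:C%C)) ((expR x)%:C%C).
Proof.
have h N : exp_sum (x%:C%C) N = (exp_sum x N)%:C%C.
  rewrite rmorph_sum; apply: eq_bigr => m _.
  by rewrite fmorph_div rmorphXn rmorph_nat.
split => /=.
  rewrite (_ : (fun n => _) = exp_sum x); first exact: exp_sum_cvg.
  by apply/funext => N; rewrite h.
rewrite (_ : (fun n => _) = fun=> 0); first exact: cvg_cst.
by apply/funext => N; rewrite h.
Qed.

(** Unitarity of W(w): for u = v = w the parameters b + c and a + d vanish, and only the diagonal
    coefficient 1 / k! of exp (s t) remains. *)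
Lemma weyl_weight_row_cvg (R : realType) (w : R[i]) (k : nat) :
  \sum_(m < N) weyl_weight w m k @[N --> \oo] --> expR (csq w).
Proof.
have := exp_sumR_cvg R (csq w); rewrite -[(csq w)%:C%C]conjc_mul_self => hE.
have := weyl_prod_cvg R (conjc w) (- w) w (- conjc w) _ k k hE.
rewrite addNr subrr weyl_coef00.
move=> /(ccvgM _ _ _ _ (ccvg_cst k`!%:R)) [+ _].
rewrite mulrCA mulfV ?natr_fact_neq0 // mulr1 /= => h.
rewrite (_ : (fun N => _) = fun N =>
  complex.Re (k`!%:R * weyl_prod (conjc w) (- w) w (- conjc w) k k N)) //.
apply/funext => N; rewrite mulr_sumr raddf_sum; apply: eq_bigr => m _.
have -> : weyl_coef (conjc w) (- w) m k = conjc (weyl_coef w (- conjc w) m k).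
  by rewrite (rmorph_weyl_coef _ _ (@conjc R)) rmorphN /= conjcK.
by rewrite -mulrA conjc_mul_self !complexr_nat !complexrM /= /weyl_weight; ring.
Qed.

(** Each row sum tends to exp (|w|^2) >= 1, so K rows, cut far enough out, contribute at least 1/2
    each. *)
Lemma weyl_weight_box_unbounded (R : realType) (w : R[i]) (M : R) :
  exists N, M <= \sum_(k < N) \sum_(l < N) weyl_weight w k l.
Proof.
have step K : exists N0, forall N, (N0 <= N)%N ->
    K%:R / 2 <= \sum_(k < K) \sum_(m < N) weyl_weight w m k.
  elim: K => [|K [N0 IH]]; first by exists 0%N => N _; rewrite big_ord0 mul0r.
  have := weyl_weight_row_cvg R w K; move/(@cvgrPdist_le _ R^o) => /(_ (2^-1)).
  have h2 : 0 < 2^-1 :> R by rewrite invr_gt0.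
  move=> /(_ h2) [N1 _ h1]; exists (maxn N0 N1) => N.
  rewrite geq_max => /andP[/IH hN0 /h1 /= hN1].
  rewrite big_ord_recr /= -natr1 mulrDl; apply: lerD => //.
  have hx : 1 <= expR (csq w) by rewrite -expR0 ler_expR csq_ge0.
  by move: hN1; rewrite ler_distl => /andP[]; lra.
have [K hK] : exists K : nat, M <= K%:R / 2.
  exists (Num.bound `|2 * M|).
  rewrite ler_pdivlMr // mulrC.
  by apply: le_trans (ler_norm _) _; apply: ltW; exact: archi_boundP (normr_ge0 _).
have [N0 hN0] := step K; exists (maxn K N0).
apply: le_trans hK _; apply: le_trans (hN0 _ (leq_maxr K N0)) _.
(* The K rows are completed to a square box by nonnegative terms, and symmetry of the weight
   restores the order of the indices. *)
rewrite (big_ord_widen (maxn K N0)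
  (fun k => \sum_(m < maxn K N0) weyl_weight w m k)) ?leq_maxl //.
rewrite big_mkcond /=; apply: ler_sum => k _; rewrite [leRHS](_ : _ =
  \sum_(m < maxn K N0) weyl_weight w m k); last first.
  by apply: eq_bigr => m _; exact: weyl_weightC.
by case: ifP => // _; apply: sumr_ge0 => m _; exact: weyl_weight_ge0.
Qed.

(* The weight is symmetric, so that A^k B^l may be replaced by
   (A^k B^l + A^l B^k) / 2, which is at least 1. *)
Lemma thermal_box_unbounded (R : realType) (w : R[i]) (A B M : R) :
  0 < A -> 0 < B -> 1 <= A * B ->
  exists N, M <= \sum_(k < N) \sum_(l < N) A ^+ k * B ^+ l * weyl_weight w k l.
Proof.
move=> A0 B0 AB; have [N hN] := weyl_weight_box_unbounded R w M; exists N.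
apply: le_trans hN _.
set S := (X in _ <= X).
have hS : S = \sum_(k < N) \sum_(l < N) A ^+ l * B ^+ k * weyl_weight w k l.
  rewrite /S exchange_big /=; apply: eq_bigr => k _; apply: eq_bigr => l _.
  by rewrite weyl_weightC.
suff : 2 * \sum_(k < N) \sum_(l < N) weyl_weight w k l <= S + S by lra.
rewrite {2}hS /S -big_split /= mulr_sumr; apply: ler_sum => k _.
rewrite -big_split /= mulr_sumr; apply: ler_sum => l _.
rewrite -mulrDl; apply: ler_wpM2r; first exact: weyl_weight_ge0.
have h1 : 0 < A ^+ k * B ^+ l by rewrite mulr_gt0 ?exprn_gt0.
have h2 : 0 < A ^+ l * B ^+ k by rewrite mulr_gt0 ?exprn_gt0.
(* The product of the two monomials is (A B)^(k + l). *)
have h3 : 1 <= (A ^+ k * B ^+ l) * (A ^+ l * B ^+ k).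
  rewrite mulrACA -exprD (addnC k) -exprD addnC -exprMn; exact: exprn_ege1.
move: (A ^+ k * B ^+ l) (A ^+ l * B ^+ k) h1 h2 h3 => x y x0 y0 xy.
by have := sqr_ge0 (x - y); nra.
Qed.

(** * Bounds on the weight, and convergence for A B < 1 *)

Lemma csq_sum_le (R : realType) (z : nat -> R[i]) (n : nat) :
  csq (\sum_(p < n) z p) <= n%:R * \sum_(p < n) csq (z p).
Proof.
rewrite csqE; apply: le_trans (_ : (\sum_(p < n) normc (z p)) ^+ 2 <= _).
  rewrite ler_sqr ?nnegrE ?normc_ge0 ?sumr_ge0 // => [|p _]; last exact: normc_ge0.
  exact: le_normc_sum.
under [X in _ <= _ * X]eq_bigr do rewrite csqE.
elim: n => [|n IH]; first by rewrite !big_ord0 expr0n mulr0.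
rewrite !big_ord_recr /= -natr1.
case: n IH => [|n] IH; first by rewrite !big_ord0 !add0r mul1r.
move: IH; set S := \sum_(_ < _) _; set Q := \sum_(_ < _) _; set r := normc _ => IH.
have n0 : 0 < n.+1%:R :> R by rewrite ltr0n.
move: n0 IH; move: (n.+1%:R : R) => x x0 IH.
(* Multiplied by x, this follows from S^2 <= x Q and (S - x r)^2 >= 0. *)
suff : 2 * S * r <= Q + x * r ^+ 2 by nra.
by rewrite -(ler_pM2l x0); have := sqr_ge0 (S - x * r); nra.
Qed.

(** 'C(k, p) e^(k - p) is one of the nonnegative terms in the expansion of (1 + e)^k. *)
Lemma bin_mul_expr_le (R : realType) (e : R) (k p : nat) :
  0 < e -> (p <= k)%N -> 'C(k, p)%:R <= (1 + e) ^+ k * e^-1 ^+ (k - p).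
Proof.
move=> e0 pk; rewrite exprVn ler_pdivlMr ?exprn_gt0 //.
rewrite addrC exprDn (bigD1 (Ordinal (pk : (p < k.+1)%N))) //=.
rewrite expr1n mulr1 mulrC mulr_natr lerDl; apply: sumr_ge0 => i _.
by rewrite expr1n mulr1 mulrn_wge0 ?exprn_ge0 // ltW.
Qed.

Lemma natr_le_expr (R : realType) (e : R) (k : nat) :
  0 < e -> e <= 1 -> k.+1%:R <= e^-1 * (1 + e) ^+ k.
Proof.
move=> e0 e1; rewrite mulrC ler_pdivlMr //.
elim: k => [|k IH]; first by rewrite expr0 mul1r.
rewrite -natr1 mulrDl mul1r exprS mulrDl mul1r.
apply: lerD => //; rewrite -[leLHS]mulr1 ler_pM2l // exprn_ege1 //; lra.
Qed.

(** Cauchy-Schwarz over the k + 1 values of p costs a factor k + 1. In each squared term, k! l!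
    combines with the factorials into 'C(k, p) 'C(l, p) / ((k - p)! (l - p)!). Bounding k + 1 and
    both binomials by powers of 1 + e leaves powers of 1 / e, absorbed into [csq w / e]. *)
Lemma weyl_weight_le (R : realType) (w : R[i]) (e : R) (k l N : nat) :
  0 < e -> e <= 1 -> (k < N)%N ->
  weyl_weight w k l <= \sum_(p < N | (p <= k)%N && (p <= l)%N)
    e^-1 * ((1 + e) ^+ 2) ^+ k * (1 + e) ^+ l *
      (((csq w / e) ^+ (k - p) / (k - p)`!%:R) * ((csq w / e) ^+ (l - p) / (l - p)`!%:R)).
Proof.
move=> e0 e1 kN.
have e10 : 0 < 1 + e by lra.
rewrite /weyl_weight (weyl_coef_widen _ _ _ _ _ k.+1); last by lia.
apply: le_trans (ler_wpM2l _ (csq_sum_le _ _ _)) _; first by rewrite mulr_ge0.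
rewrite (big_ord_widen N (fun p => csq (weyl_term w (- conjc w) k l p))) //.
rewrite mulrA mulr_sumr big_mkcond [leRHS]big_mkcond /=.
apply: ler_sum => p _; rewrite ltnS /weyl_term.
case: (boolP (p <= k)%N) => //= pk; case: (boolP (p <= l)%N) => //= pl; last first.
  by rewrite (csqR _ 0) expr0n mulr0.
rewrite !csqM csqX csqX csqN csq_conjc.
set x := csq w.
have csqV n : csq ((n`!%:R : R[i])^-1) = (n`!%:R ^- 2 : R).
  by rewrite csqE normcV normc_natr exprVn.
rewrite !invfM !csqM !csqV.
rewrite [leLHS](_ : _ = k.+1%:R * 'C(k, p)%:R * 'C(l, p)%:R *
   ((x ^+ (k - p) / (k - p)`!%:R) * (x ^+ (l - p) / (l - p)`!%:R))); last first.
  have := bin_fact pk => /(congr1 (fun k => k%:R : R)); rewrite !natrM => <-.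
  have := bin_fact pl => /(congr1 (fun k => k%:R : R)); rewrite !natrM => <-.
  have f1 := natr_fact_neq0 R p; have f2 := natr_fact_neq0 R (k - p).
  have f3 := natr_fact_neq0 R (l - p).
  move: k.+1%:R => y.
  by field; rewrite f1 f2 f3.
rewrite !(exprMn _ x).
set X := x ^+ (k - p) / _; set Y := x ^+ (l - p) / _.
have X0 : 0 <= X by rewrite divr_ge0 ?exprn_ge0 ?csq_ge0.
have Y0 : 0 <= Y by rewrite divr_ge0 ?exprn_ge0 ?csq_ge0.
rewrite [leRHS](_ : _ = (e^-1 * (1 + e) ^+ k) * ((1 + e) ^+ k * e^-1 ^+ (k - p)) *
   ((1 + e) ^+ l * e^-1 ^+ (l - p)) * (X * Y)); last first.
  by rewrite -exprM mulnC exprM /X /Y; ring.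
apply: ler_wpM2r; first exact: mulr_ge0.
have ei : 0 < e^-1 by rewrite invr_gt0.
apply: ler_pM => //; last exact: bin_mul_expr_le.
apply: ler_pM => //; [exact: natr_le_expr | exact: bin_mul_expr_le].
Qed.

Lemma sum_shift_le (R : realType) (h : nat -> R) (p N : nat) :
  (forall n, 0 <= h n) -> \sum_(k < N | (p <= k)%N) h (k - p)%N <= \sum_(n < N) h n.
Proof.
move=> h0; rewrite -(big_mkord (fun k => (p <= k)%N) (fun k => h (k - p)%N)).
rewrite -(big_mkord xpredT h).
case: (leqP p N) => pN; last first.
  rewrite big_nat_cond big1 ?sumr_ge0 // => k /andP[/andP[_ kN]]; lia.
rewrite (@big_cat_nat _ _ _ p) //= big_nat_cond big1 ?add0r; last first.
  by move=> k /andP[/andP[_ kp]]; rewrite leqNgt kp.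
rewrite -{1}[p]add0n big_addn [leRHS](@big_cat_nat _ _ _ (N - p)) ?leq_subr //=.
rewrite big_mkcond /= -[leLHS]addr0; apply: lerD; last exact: sumr_ge0.
by apply: ler_sum => k _; rewrite addnK; case: ifP.
Qed.

Lemma geometric_sum_le (R : realType) (q : R) (N : nat) :
  0 <= q -> q < 1 -> \sum_(p < N) q ^+ p <= (1 - q)^-1.
Proof.
move=> q0 q1; rewrite -[(1 - q)^-1]mul1r ler_pdivlMr ?subr_gt0 //.
by have := subrX1 q N; have := exprn_ge0 N q0; lra.
Qed.

Lemma exp_sum_le (R : realType) (x : R) (N : nat) : 0 <= x -> exp_sum x N <= expR x.
Proof.
move=> x0; have h := exp_sum_cvg R x.
rewrite -(cvg_lim _ h) //; apply: nondecreasing_cvgn_le; last exact: cvgP h.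
apply/nondecreasing_seqP => n; rewrite /exp_sum big_ord_recr /= lerDl.
by rewrite divr_ge0 ?exprn_ge0.
Qed.

Lemma thermal_box_bounded (R : realType) (w : R[i]) (A B : R) :
  0 < A -> 0 < B -> A * B < 1 ->
  exists M, forall N, \sum_(k < N) \sum_(l < N) A ^+ k * B ^+ l * weyl_weight w k l <= M.
Proof.
move=> A0 B0 AB.
(* For 0 < e <= 1, (1 + e)^3 <= 1 + 7 e; with q = A B this choice gives q (1 + 7 e) = q (2 - q) = 1
   - (1 - q)^2 < 1. *)
pose e := (1 - A * B) / 7.
have q0 : 0 < A * B by exact: mulr_gt0.
have e0 : 0 < e by rewrite /e; lra.
have e1 : e <= 1 by rewrite /e; lra.
pose A' := A * (1 + e) ^+ 2; pose B' := B * (1 + e).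
have A'0 : 0 < A' by rewrite mulr_gt0 ?exprn_gt0 //; lra.
have B'0 : 0 < B' by rewrite mulr_gt0 //; lra.
have hAB : A' * B' < 1.
  have -> : A' * B' = A * B * (1 + e) ^+ 3 by rewrite /A' /B'; ring.
  have h : (1 + e) ^+ 3 <= 1 + 7 * e by nra.
  apply: le_lt_trans (_ : A * B * (1 + 7 * e) < 1); first by rewrite ler_pM2l.
  by rewrite /e; nra.
pose X := A' * (csq w / e); pose Y := B' * (csq w / e).
have c0 : 0 <= csq w / e by rewrite divr_ge0 ?csq_ge0 // ltW.
have X0 : 0 <= X by rewrite mulr_ge0 // ltW.
have Y0 : 0 <= Y by rewrite mulr_ge0 // ltW.
have ei : 0 <= e^-1 by rewrite invr_ge0 ltW.
exists (e^-1 * (1 - A' * B')^-1 * (expR X * expR Y)) => N.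
pose g (Z : R) n := Z ^+ n / n`!%:R.
have g0 Z n : 0 <= Z -> 0 <= g Z n by move=> Z0; rewrite divr_ge0 ?exprn_ge0.
(* Splitting A'^k as A'^p A'^(k - p), and B'^l likewise, separates a geometric factor in p from
   exponential terms in k - p and l - p. *)
apply: le_trans (_ : \sum_(k < N) \sum_(l < N) \sum_(p < N | (p <= k)%N && (p <= l)%N)
   e^-1 * (A' * B') ^+ p * (g X (k - p)%N * g Y (l - p)%N) <= _).
  apply: ler_sum => k _; apply: ler_sum => l _.
  have AB0 : 0 <= A ^+ k * B ^+ l by rewrite mulr_ge0 ?exprn_ge0 // ltW.
  apply: le_trans (ler_wpM2l AB0 (weyl_weight_le _ _ _ _ _ _ e0 e1 (ltn_ord k))) _.
  rewrite mulr_sumr; apply: ler_sum => p /andP[pk pl].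
  rewrite /g /X /Y [(A' * B') ^+ _]exprMn [(A' * (csq w / e)) ^+ _]exprMn
    [(B' * (csq w / e)) ^+ _]exprMn.
  have -> : A' ^+ p = A' ^+ k / A' ^+ (k - p).
    by rewrite -{1}(subnKC pk) exprD mulfK // expf_neq0 // gt_eqF.
  have -> : B' ^+ p = B' ^+ l / B' ^+ (l - p).
    by rewrite -{1}(subnKC pl) exprD mulfK // expf_neq0 // gt_eqF.
  rewrite {1}/A' {1}/B' [(A * _ ^+ 2) ^+ k]exprMn [(B * _) ^+ l]exprMn.
  have f1 : A' ^+ (k - p) != 0 by rewrite expf_neq0 // gt_eqF.
  have f2 : B' ^+ (l - p) != 0 by rewrite expf_neq0 // gt_eqF.
  rewrite le_eqVlt; apply/orP; left; apply/eqP.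
  move: (csq w / e) (A' ^+ (k - p)) (B' ^+ (l - p)) f1 f2 => z a b f1 f2.
  have f3 := natr_fact_neq0 R (k - p).
  have f4 := natr_fact_neq0 R (l - p).
  by field; rewrite f1 f2 f3 f4 gt_eqF.
under eq_bigr do under eq_bigr do rewrite big_mkcond.
under eq_bigr do rewrite exchange_big /=.
rewrite exchange_big /=.
apply: le_trans (_ : \sum_(p < N) e^-1 * (A' * B') ^+ p * (exp_sum X N * exp_sum Y N) <= _).
  apply: ler_sum => p _.
  have D0 : 0 <= e^-1 * (A' * B') ^+ p by rewrite mulr_ge0 // exprn_ge0 // mulr_ge0 // ltW.
  rewrite [leLHS](_ : _ = e^-1 * (A' * B') ^+ p *
     ((\sum_(k < N | (p <= k)%N) g X (k - p)%N) * (\sum_(l < N | (p <= l)%N) g Y (l - p)%N))).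
    apply: ler_wpM2l => //; apply: ler_pM.
    - by apply: sumr_ge0 => k _; exact: g0.
    - by apply: sumr_ge0 => k _; exact: g0.
    - by apply: (sum_shift_le _ (g X)) => n; exact: g0.
    - by apply: (sum_shift_le _ (g Y)) => n; exact: g0.
  rewrite big_distrlr /= mulr_sumr [RHS]big_mkcond; apply: eq_bigr => k _.
  rewrite mulr_sumr; case: ifP => _ /=; last by rewrite big1.
  by rewrite [RHS]big_mkcond.
rewrite -mulr_suml -mulr_sumr; apply: ler_pM.
- by rewrite mulr_ge0 // sumr_ge0 // => p _; rewrite exprn_ge0 // mulr_ge0 // ltW.
- by rewrite mulr_ge0 // sumr_ge0 // => p _; exact: g0.
- apply: ler_wpM2l => //; apply: geometric_sum_le => //.
  by rewrite mulr_ge0 // ltW.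
- apply: ler_pM; rewrite ?exp_sum_le // sumr_ge0 // => p _; exact: g0.
Qed.

(** * Sums over pairs of multi-indices of products over the modes *)

Lemma range_finType (T : finType) (I : choiceType) (h : T -> I) :
  range h = [set` [seq h t | t <- enum T]].
Proof.
apply/seteqP; split => [_ [t _ <-]|x /= /mapP[t _ ->]]; last by exists t.
by apply/mapP; exists t => //; rewrite mem_enum.
Qed.

Lemma finite_range_finType (T : finType) (I : choiceType) (h : T -> I) :
  finite_set (range h).
Proof. by rewrite range_finType; exact: finite_seq. Qed.

Lemma fsum_range_finType (R : realDomainType) (T : finType) (I : choiceType) (h : T -> I)
  (f : I -> R) : injective h ->
  (\sum_(x \in range h) (f x)%:E)%E = (\sum_(t : T) f (h t))%:E.
Proof.
move=> hinj; rewrite range_finType -fsbig_seq; last by rewrite map_inj_uniq // enum_uniq.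
by rewrite big_map big_enum sumEFin.
Qed.

Definition prod_term {R : realType} {n : nat} (g : 'I_n -> nat -> nat -> R)
  (ij : mindex n * mindex n) : R := \prod_(j < n) g j (ij.1 j) (ij.2 j).

(** Every finite set of pairs lies in a box, and the sum over a box is the product of the one-mode
    box sums. *)
Lemma esum_prod_lty (R : realType) (n : nat) (g : 'I_n -> nat -> nat -> R) :
  (forall j k l, 0 <= g j k l) ->
  (forall j, exists M, forall N, \sum_(k < N) \sum_(l < N) g j k l <= M) ->
  (\esum_(ij in [set: mindex n * mindex n]) (prod_term g ij)%:E < +oo)%E.
Proof.
move=> g_ge0 /choice[M hM].
apply: le_lt_trans (ltry (\prod_j M j)).
apply: ge_ereal_sup => _ [F [finF _] <-].
have /finite_seqP[s sF] := finF.
(* N exceeds every entry of every pair in F, and the range of [h] is the box of side N. *)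
pose N := (\max_(x <- s) \max_(j < n) maxn (x.1 j) (x.2 j)).+1%N.
pose h (y : {ffun 'I_n -> 'I_N * 'I_N}) : mindex n * mindex n :=
  ([ffun j => nat_of_ord (y j).1], [ffun j => nat_of_ord (y j).2]).
have hinj : injective h.
  move=> y z [/ffunP e1 /ffunP e2]; apply/ffunP => j.
  move: (e1 j) (e2 j); rewrite !ffunE.
  by case: (y j) (z j) => a b [c d] /= /val_inj -> /val_inj ->.
have Fh : F `<=` range h.
  move=> x; rewrite sF /= => xs.
  have hx j : (maxn (x.1 j) (x.2 j) < N)%N.
    rewrite ltnS; apply: leq_trans (_ : \max_(j < n) maxn (x.1 j) (x.2 j) <= _)%N.
      exact: (@leq_bigmax _ (fun j => maxn (x.1 j) (x.2 j)) j).
    exact: (@leq_bigmax_seq _ s xpredT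
      (fun x : mindex n * mindex n => \max_(j < n) maxn (x.1 j) (x.2 j))%N x xs isT).
  exists [ffun j => (inord (x.1 j), inord (x.2 j))] => //.
  case: x hx {xs} => x1 x2 /= hx; congr (_, _); apply/ffunP => j; rewrite !ffunE /=.
    by rewrite inordK //; apply: leq_ltn_trans (hx j); exact: leq_maxl.
  by rewrite inordK //; apply: leq_ltn_trans (hx j); exact: leq_maxr.
have finh := finite_range_finType _ _ h.
apply: (@le_trans _ _ (\sum_(x \in range h) (prod_term g x)%:E)%E).
  apply: lee_fsum_nneg_subset => //; first exact/subsetP.
  by move=> x _; rewrite lee_fin; exact: prodr_ge0.
rewrite fsum_range_finType // lee_fin.
have -> : \sum_(y : {ffun 'I_n -> 'I_N * 'I_N}) prod_term g (h y) =
    \prod_(j < n) \sum_(q : 'I_N * 'I_N) g j q.1 q.2.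
  rewrite bigA_distr_bigA; apply: eq_bigr => y _; apply: eq_bigr => j _.
  by rewrite !ffunE.
apply: ler_prod => j _; apply/andP; split; first exact: sumr_ge0.
by rewrite -(pair_bigA _ (fun k l : 'I_N => g j k l)) /= hM.
Qed.

(** Restrict to pairs that vanish outside the mode [j0]: the other modes then contribute the fixed
    positive factor [c]. *)
Lemma esum_prod_eqy (R : realType) (n : nat) (g : 'I_n -> nat -> nat -> R) (j0 : 'I_n) :
  (forall j, 0 < g j 0 0) ->
  (forall M, exists N, M <= \sum_(k < N) \sum_(l < N) g j0 k l) ->
  (\esum_(ij in [set: mindex n * mindex n]) (prod_term g ij)%:E = +oo)%E.
Proof.
move=> g00 gM; apply/eqyP => A _.
pose c := \prod_(j < n | j != j0) g j 0%N 0%N.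
have c0 : 0 < c by exact: prodr_gt0.
have [N hN] := gM (A / c).
pose h (q : 'I_N * 'I_N) : mindex n * mindex n :=
  ([ffun j => if j == j0 then nat_of_ord q.1 else 0%N],
   [ffun j => if j == j0 then nat_of_ord q.2 else 0%N]).
have hinj : injective h.
  move=> [a b] [a' b'] [/ffunP/(_ j0) + /ffunP/(_ j0)].
  by rewrite !ffunE eqxx => /= /val_inj -> /val_inj ->.
apply: esum_ge; exists (range h); first by split => //; exact: finite_range_finType.
rewrite fsum_range_finType // lee_fin.
have -> : \sum_q prod_term g (h q) = (\sum_(k < N) \sum_(l < N) g j0 k l) * c.
  rewrite pair_bigA mulr_suml; apply: eq_bigr => q _.
  rewrite /prod_term (bigD1 j0) //= !ffunE eqxx; congr (_ * _).
  by apply: eq_bigr => j /negbTE j0j; rewrite !ffunE j0j.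
by rewrite -ler_pdivrMr.
Qed.

Lemma esum_prod_gt0 (R : realType) (n : nat) (g : 'I_n -> nat -> nat -> R) :
  (forall j, 0 < g j 0 0) ->
  (0 < \esum_(ij in [set: mindex n * mindex n]) (prod_term g ij)%:E)%E.
Proof.
move=> g00; pose o : mindex n := [ffun=> 0%N].
apply: (@lt_le_trans _ _ (prod_term g (o, o))%:E).
  by rewrite lte_fin; apply: prodr_gt0 => j _; rewrite !ffunE.
by apply: esum_ge; exists [set (o, o)]; rewrite ?fsbig_set1.
Qed.

(** * The contribution of one mode to the Petz-Renyi sum *)

Lemma powR_prod (R : realType) (I : finType) (f : I -> R) (a : R) :
  (forall i, 0 <= f i) -> (\prod_i f i) `^ a = \prod_i f i `^ a.
Proof.
move=> f0.
(* Nonnegativity is carried through the induction because [powRM] requires it. *)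
suff [] : (\prod_i f i) `^ a = \prod_i f i `^ a /\ 0 <= \prod_i f i by [].
elim/big_ind2: _ => [|x1 x2 y1 y2 [<- h1] [<- h2]|//]; first by rewrite powR1.
by split; [rewrite powRM|rewrite mulr_ge0].
Qed.

Lemma thermal_eig_gt0 (R : realType) (s : R) (k : nat) : 0 < s -> 0 < thermal_eig s k.
Proof. by move=> s0; rewrite mulr_gt0 ?expR_gt0 // subr_gt0 expR_lt1 oppr_lt0. Qed.

Lemma powR_thermal_eig (R : realType) (s a : R) (k : nat) : 0 < s ->
  thermal_eig s k `^ a = (1 - expR (- s)) `^ a * expR (- (a * s)) ^+ k.
Proof.
move=> s0; rewrite /thermal_eig powRM ?expR_ge0 //; last first.
  by rewrite subr_ge0 expR_le1 oppr_le0 ltW.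
by congr (_ * _); rewrite -expRM -expRM_natl; congr expR; ring.
Qed.

Definition mode_term {R : realType} (alpha r s : R) (u1 u2 : R[i]) (k l : nat) : R :=
  thermal_eig r k `^ alpha * thermal_eig s l `^ (1 - alpha) * overlap_sq u1 u2 k l.

Lemma mode_termE (R : realType) (alpha r s : R) (u1 u2 : R[i]) : 0 < r -> 0 < s ->
  exists2 c : R, 0 < c & forall k l, mode_term alpha r s u1 u2 k l =
    c * (expR (- (alpha * r)) ^+ k * expR (- ((1 - alpha) * s)) ^+ l *
      weyl_weight (u2 - u1) k l).
Proof.
move=> r0 s0; have [c c0 hc] := overlap_sqE R u1 u2.
exists ((1 - expR (- r)) `^ alpha * (1 - expR (- s)) `^ (1 - alpha) * c).
  by rewrite !mulr_gt0 ?powR_gt0 // subr_gt0 expR_lt1 oppr_lt0.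
by move=> k l; rewrite /mode_term !powR_thermal_eig // hc; ring.
Qed.

Lemma mode_term_ge0 (R : realType) (alpha r s : R) (u1 u2 : R[i]) (k l : nat) :
  0 <= mode_term alpha r s u1 u2 k l.
Proof. by rewrite !mulr_ge0 ?powR_ge0 // addr_ge0 ?sqr_ge0. Qed.

Lemma mode_term00_gt0 (R : realType) (alpha r s : R) (u1 u2 : R[i]) :
  0 < r -> 0 < s -> 0 < mode_term alpha r s u1 u2 0 0.
Proof.
move=> r0 s0; have [c c0 ->] := mode_termE R alpha r s u1 u2 r0 s0.
by rewrite weyl_weight00 !expr0 !mulr1.
Qed.

(** For the two ratios A and B in [mode_termE], A B = exp ((alpha - 1) s - alpha r), so the
    hypothesis says A B < 1. *)
Lemma mode_term_box_bounded (R : realType) (alpha r s : R) (u1 u2 : R[i]) :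
  0 < r -> 0 < s -> (alpha - 1) * s < alpha * r ->
  exists M, forall N, \sum_(k < N) \sum_(l < N) mode_term alpha r s u1 u2 k l <= M.
Proof.
move=> r0 s0 h; have [c c0 hc] := mode_termE R alpha r s u1 u2 r0 s0.
have [||| M hM] := thermal_box_bounded R (u2 - u1)
  (expR (- (alpha * r))) (expR (- ((1 - alpha) * s))); rewrite ?expR_gt0 //.
  by rewrite -expRD expR_lt1; nra.
exists (c * M) => N.
under eq_bigr do under eq_bigr do rewrite hc.
under eq_bigr do rewrite -mulr_sumr.
by rewrite -mulr_sumr ler_pM2l.
Qed.

Lemma mode_term_box_unbounded (R : realType) (alpha r s : R) (u1 u2 : R[i]) (M : R) :
  0 < r -> 0 < s -> alpha * r <= (alpha - 1) * s ->
  exists N, M <= \sum_(k < N) \sum_(l < N) mode_term alpha r s u1 u2 k l.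
Proof.
move=> r0 s0 h; have [c c0 hc] := mode_termE R alpha r s u1 u2 r0 s0.
have [||| N hN] := thermal_box_unbounded R (u2 - u1)
  (expR (- (alpha * r))) (expR (- ((1 - alpha) * s))) (M / c); rewrite ?expR_gt0 //.
  by rewrite -expRD -[leLHS]expR0 ler_expR; nra.
exists N.
under eq_bigr do under eq_bigr do rewrite hc.
under eq_bigr do rewrite -mulr_sumr.
by rewrite -mulr_sumr mulrC -ler_pdivrMr.
Qed.

(** * The relative entropy and the threshold on alpha *)

Lemma D_gaussE (R : realType) (n : nat) (alpha : R) (r s : 'I_n -> R)
  (u1 u2 : 'I_n -> R[i]) : (forall j, 0 < r j) -> (forall j, 0 < s j) ->
  D_gauss alpha r s u1 u2 = (((alpha - 1)^-1)%:E *
    elog (\esum_(ij in [set: mindex n * mindex n])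
      (\prod_(j < n) mode_term alpha (r j) (s j) (u1 j) (u2 j) (ij.1 j) (ij.2 j))%:E))%E.
Proof.
move=> r0 s0; rewrite /D_gauss /petz_renyi; congr (_ * elog _)%E.
apply: eq_esum => -[k l] _ /=; rewrite /epow_neg.
(* The eigenvalues of sigma are positive, so [epow_neg] is an ordinary power and the summand factors
   over the modes. *)
have q0 : 0 < thermal_eig_n s l by apply: prodr_gt0 => j _; exact: thermal_eig_gt0.
rewrite gt_eqF //= -!EFinM; congr (_%:E).
by rewrite !powR_prod -?big_split // => j; apply/ltW/thermal_eig_gt0.
Qed.

(** If r < s, multiply by s - r. If r >= s, the left side always holds, since alpha r >= alpha s >
    (alpha - 1) s. *)
Lemma lt_divB_iff (R : realType) (alpha r s : R) : 0 < alpha -> 0 < r -> 0 < s ->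
  (alpha - 1) * s < alpha * r <-> (r < s -> alpha < s / (s - r)).
Proof.
move=> a0 r0 s0; split => [h rs|h].
  by rewrite ltr_pdivlMr ?subr_gt0 //; nra.
case: (ltP r s) => [rs|]; last by nra.
by have := h rs; rewrite ltr_pdivlMr ?subr_gt0 //; nra.
Qed.

(** Being below the minimum is expressed as being below each of its members; this is vacuous for the
    empty set, in agreement with the value +oo. *)
Theorem theorem3p9 (R : realType) (n : nat) (r s : 'I_n -> R) (u1 u2 : 'I_n -> R[i])
  (alpha : R) :
  (0 < n)%N ->
  (forall j, 0 < r j) -> (forall j, 0 < s j) ->
  0 < alpha -> alpha != 1 ->
  ((D_gauss alpha r s u1 u2 < +oo)%E <->
   (forall j : 'I_n, r j < s j -> alpha < s j / (s j - r j))).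
Proof.
move=> _ r0 s0 a0 a1; rewrite D_gaussE //.
pose g j := mode_term alpha (r j) (s j) (u1 j) (u2 j).
have g0 j k l : 0 <= g j k l by exact: mode_term_ge0.
have g00 j : 0 < g j 0%N 0%N by exact: mode_term00_gt0.
case: (ltgtP alpha 1) a1 => // a1 _.
  (* For alpha < 1 the condition holds for every mode, as (alpha - 1) s < 0 < alpha r. *)
  split => [_ j rs|_].
    move: rs; apply/lt_divB_iff => //; have := mulr_gt0 a0 (r0 j); have := s0 j; nra.
  (* The prefactor is negative, so the entropy could be +oo only if the logarithm were -oo, which
     positivity of the sum excludes. *)
  have := esum_prod_gt0 _ _ g g00.
  have ai : (alpha - 1)^-1 < 0 by rewrite invr_lt0 subr_lt0.
  case: (\esum_(ij in _) _) => [x| |] //; rewrite ?lte_fin /= => x0.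
    by rewrite x0 -EFinM ltry.
  by rewrite lt0_muley ?lte_fin.
have ai : 0 < (alpha - 1)^-1 by rewrite invr_gt0 subr_gt0.
split => [h j rs|h].
  (* A single mode that violates the condition makes the whole sum infinite, and the prefactor is
     now positive. *)
  move: rs; apply/lt_divB_iff => //; rewrite ltNge; apply/negP => hj.
  move: h; rewrite (esum_prod_eqy _ _ g j) //= ?gt0_muley ?lte_fin // => M.
  exact: mode_term_box_unbounded.
have := esum_prod_lty _ _ g g0 (fun j =>
  mode_term_box_bounded _ _ _ _ (u1 j) (u2 j) (r0 j) (s0 j)
    (proj2 (lt_divB_iff _ _ _ _ a0 (r0 j) (s0 j)) (h j))).
case: (\esum_(ij in _) _) => [x| |] //= _; last by rewrite gt0_muleNy ?lte_fin.
by case: ifP => _; rewrite -?EFinM ?ltry // gt0_muleNy ?lte_fin.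
Qed.
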